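(* Let $\vec G=(G,\alpha,w)$ be a finite magnetic graph with vertex set $V$, let $V_0\subseteq V$ and let $V_1\subsetneq V_0$ be a proper subset (the distinguished vertices). Then for any two different $s$-partitions $A$ and $B$ of a natural number $r\ge 4$, the $V_1$-contracted $A$-union $\vec F_{A,V_1}$ and $V_1$-contracted $B$-union $\vec F_{B,V_1}$ of the frame $(F_a(\vec G,V_0))_{a\in\mathbb{N}}$ are isospectral and not isomorphic.
   Context: A graph $G=(V,E,\partial)$: finite disjoint sets $V,E$, incidence $\partial e=(\partial_-e,\partial_+e)$, inversion $e\mapsto\bar e$ ($\bar{\bar e}=e$, $\bar e\ne e$, $\partial_\pm\bar e=\partial_\mp e$); loops/multiple edges allowed; $E_v=\{e:\partial_-e=v\}$, $\deg v=|E_v|>0$. A magnetic graph $\vec G=(G,\alpha,w)$ has $w:E\to(0,\infty)$, $w_{\bar e}=w_e$, and $\alpha:E\to\mathbb{R}/2\pi\mathbb{Z}$, $\alpha_{\bar e}=-\alpha_e$; $\deg^wv=\sum_{e\in E_v}w_e$. The magnetic Laplacian on $\ell^2(V,\deg^w)$ is $(\Delta f)(v)=f(v)-\frac1{\deg^wv}\sum_{e\in E_v}w_ee^{i\alpha_e}f(\partial_+e)$; two magnetic graphs are isospectral if their Laplacians have the same eigenvalues with the same multiplicities, and isomorphic if there is a graph isomorphism (bijections on vertices and edges commuting with incidence and inversion) preserving $w$ and $\alpha$. Contraction of vertices along an equivalence relation keeps all edges (with weights and potentials) and replaces vertices by classes. Frame member: $G^a$ is the disjoint union of $a$ copies $G\times\{j\}$;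 with $(v,i)\sim(v',j)$ iff $(v,i)=(v',j)$ or ($v=v'\in V_0$), $F_a(\vec G,V_0)=G^a/\!\sim$ with $w_{(e,j)}=w_e$, $\alpha_{(e,j)}=\alpha_e$. An $s$-partition of $r$ is a multiset $A=\{\!\{a_1,\dots,a_s\}\!\}$ of natural numbers with sum $r$. $\vec F_A=\bigsqcup_{i=1}^sF_{a_i}(\vec G,V_0)\times\{i\}$, and $\vec F_{A,V_1}$ is obtained from $\vec F_A$ by contracting, for each $v_1\in V_1$, the $s$ vertices $([v_1],i)$, $i=1,\dots,s$, into one vertex. *)

(* Defs.v *)
From HB Require Import structures.
From mathcomp Require Import all_boot all_order all_algebra.
From mathcomp Require Import complex.
From mathcomp Require Import reals trigo.
Set Implicit Arguments. Unset Strict Implicit. Unset Printing Implicit Defensive.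
Import Order.TTheory GRing.Theory Num.Theory.
Local Open Scope ring_scope.
Local Open Scope complex_scope.

(* The potential alpha is an element of R/2πZ, represented by a real   *)
(* number; it is only ever used modulo 2π (see eqmod2pi below).        *)
Record mgraph (R : Type) : Type := MGraph {
  vert : finType;
  edge : finType;
  src : edge -> vert;
  tgt : edge -> vert;
  inv : edge -> edge;
  wt : edge -> R;
  pot : edge -> R }.

Arguments MGraph {R} vert edge src tgt inv wt pot.

Definition eqmod2pi (R : realType) (a b : R) : Prop :=
  exists k : int, a - b = k%:~R * (2 * pi).

Definition Ev (R : Type) (G : mgraph R) (v : vert G) : {set edge G} :=
  [set e | src e == v].

Definition is_mgraph (R : realType) (G : mgraph R) : Prop :=
  (forall e : edge G, inv (inv e) = e) /\
  (forall e : edge G, inv e <> e) /\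
  (forall e : edge G, src (inv e) = tgt e /\ tgt (inv e) = src e) /\
  (forall e : edge G, 0 < wt e /\ wt (inv e) = wt e) /\
  (forall e : edge G, eqmod2pi (pot (inv e)) (- pot e)) /\
  (forall v : vert G, (0 < #|Ev v|)%N).

Definition degw (R : realType) (G : mgraph R) (v : vert G) : R :=
  \sum_(e in Ev v) wt e.

Definition expi (R : realType) (a : R) : R[i] := (cos a +i* sin a).

(* The magnetic Laplacian, as a matrix in the basis of vertex indicator
   functions (vertices enumerated by enum_val):
   (Δ f)(v) = f(v) - 1/deg^w v * Σ_{e ∈ E_v} w_e e^{i α_e} f(∂_+ e). *)
Definition lap (R : realType) (G : mgraph R) : 'M[R[i]]_#|vert G| :=
  \matrix_(i, j)
    ((i == j)%:R -
     ((degw (enum_val i))^-1)%:C *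
       \sum_(e in Ev (enum_val i) | tgt e == enum_val j)
          (wt e)%:C * expi (pot e)).

(* same eigenvalues with the same multiplicities (dimension of the
   eigenspace; Δ is self-adjoint on ℓ²(V, deg^w), so this is also the
   algebraic multiplicity) *)
Definition isospectral (R : realType) (G1 G2 : mgraph R) : Prop :=
  forall l : R[i],
    \rank (eigenspace (lap G1) l) = \rank (eigenspace (lap G2) l).

Definition misomorphic (R : realType) (G1 G2 : mgraph R) : Prop :=
  exists (fV : vert G1 -> vert G2) (fE : edge G1 -> edge G2),
    bijective fV /\ bijective fE /\
    (forall e : edge G1, src (fE e) = fV (src e) /\ tgt (fE e) = fV (tgt e)) /\
    (forall e : edge G1, fE (inv e) = inv (fE e)) /\
    (forall e : edge G1, wt (fE e) = wt e) /\
    (forall e : edge G1, eqmod2pi (pot (fE e)) (pot e)).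

Definition vclasses (T : finType) (eqv : rel T) : {set {set T}} :=
  [set [set y | eqv x y] | x in [set: T]].

Definition cvert (T : finType) (eqv : rel T) : finType :=
  {X : {set T} | X \in vclasses eqv}.

Definition cls (T : finType) (eqv : rel T) (x : T) : cvert eqv :=
  exist (fun X => X \in vclasses eqv) [set y | eqv x y]
        (imset_f (fun x => [set y | eqv x y]) (in_setT x)).

Definition contract (R : Type) (G : mgraph R) (eqv : rel (vert G)) : mgraph R :=
  MGraph (cvert eqv) (edge G)
    (fun e => cls eqv (src e)) (fun e => cls eqv (tgt e)) (@inv R G)
    (@wt R G) (@pot R G).

Definition gpow (R : Type) (G : mgraph R) (a : nat) : mgraph R :=
  MGraph (prod (vert G) 'I_a) (prod (edge G) 'I_a)
    (fun e => (src e.1, e.2)) (fun e => (tgt e.1, e.2))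
    (fun e => (inv e.1, e.2)) (fun e => wt e.1) (fun e => pot e.1).

Definition frame_rel (R : Type) (G : mgraph R) (V0 : {set vert G}) (a : nat) :
  rel (vert (gpow G a)) :=
  fun x y => (x == y) || ((x.1 == y.1) && (x.1 \in V0)).

Arguments frame_rel {R G} V0 a.

Definition frame (R : Type) (G : mgraph R) (V0 : {set vert G}) (a : nat) :
  mgraph R := contract (frame_rel V0 a).

(* An s-partition A = {{a_1,...,a_s}} of r is represented by a sequence
   of positive naturals of length s with sum r (the order of the list is
   irrelevant; two partitions are equal iff the lists are permutations
   of each other). *)
Definition spartition (s r : nat) (A : seq nat) : bool :=
  [&& size A == s, all (fun a => 0 < a)%N A & sumn A == r].

Definition funion_vert (R : Type) (G : mgraph R) (V0 : {set vert G})
  (A : seq nat) : finType :=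
  {i : 'I_(size A) & vert (frame V0 (nth 0%N A i))}.

Definition funion_edge (R : Type) (G : mgraph R) (V0 : {set vert G})
  (A : seq nat) : finType :=
  {i : 'I_(size A) & edge (frame V0 (nth 0%N A i))}.

Definition funion (R : Type) (G : mgraph R) (V0 : {set vert G})
  (A : seq nat) : mgraph R :=
  MGraph (funion_vert V0 A) (funion_edge V0 A)
    (fun e : funion_edge V0 A =>
       Tagged (fun i : 'I_(size A) => vert (frame V0 (nth 0%N A i))) (src (tagged e)))
    (fun e : funion_edge V0 A =>
       Tagged (fun i : 'I_(size A) => vert (frame V0 (nth 0%N A i))) (tgt (tagged e)))
    (fun e : funion_edge V0 A =>
       Tagged (fun i : 'I_(size A) => edge (frame V0 (nth 0%N A i))) (inv (tagged e)))
    (fun e => wt (tagged e)) (fun e => pot (tagged e)).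

(* ([v], i) : the vertex of F_A which is the class of v ∈ V0 in the
   i-th component; "is_cls_of v x" says x = ([v], i) for some i. *)
Definition is_cls_of (R : Type) (G : mgraph R) (V0 : {set vert G})
  (A : seq nat) (v : vert G) (x : funion_vert V0 A) : bool :=
  [exists j : 'I_(nth 0%N A (tag x)), (v, j) \in val (tagged x)].

Arguments is_cls_of {R G V0 A} v x.

Definition funion_rel (R : Type) (G : mgraph R) (V0 V1 : {set vert G})
  (A : seq nat) : rel (funion_vert V0 A) :=
  fun x y => (x == y) ||
    [exists v, [&& v \in V1, is_cls_of v x & is_cls_of v y]].

Arguments funion_rel {R G} V0 V1 A.

Definition cfunion (R : Type) (G : mgraph R) (V0 V1 : {set vert G})
  (A : seq nat) : mgraph R :=
  @contract R (funion V0 A) (funion_rel V0 V1 A).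

(* Main.v *)
(* Functions on the [V1]-contracted [A]-union are the functions on [r] copies of [V]
   (indexed by [copies A]) that are constant on gluing classes, and the Laplacian is
   [D *m (L (x) 1) *m Q], where [L] is the Laplacian of [G], [Q] pulls back along the gluing
   and [D] averages over its fibres.  The projection [Q *m D] is block diagonal over [V];
   its block is the global average on [V1], the average over each frame member on
   [V0 \ V1], and the identity elsewhere.  The first two are nested idempotents of traces
   [1] and [s] on a space of dimension [r]; these numbers do not depend on the partition,
   so one matrix [U] conjugates the projections of [A] to those of [B].  As [1 (x) U]
   commutes with [L (x) 1], the two Laplacians are similar.

   An isomorphism preserves weighted degrees.  The contributions of vertices outside
   [V0 \ V1] depend only on [r], hence the multisets of products [a * deg v], for [a] in the
   partition and [v] in [V0 \ V1], agree; a multiset with positive entries is cancellable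
   here, which gives back the partition. *)

Require Import Defs.
From HB Require Import structures.
From mathcomp Require Import all_boot all_order all_algebra.
From mathcomp Require Import complex.
From mathcomp Require Import reals trigo.
Set Implicit Arguments. Unset Strict Implicit. Unset Printing Implicit Defensive.
Import Order.TTheory GRing.Theory Num.Theory.
Local Open Scope ring_scope.

(** * Conjugacy of idempotents and of compressions *)

Section Idempotents.

Variable F : numFieldType.

(** Take a rank factorisation [P = C D]. In [C D C D = C D], cancelling [C], of full column rank,
    and [D], of full row rank, leaves [D C = 1]. *)
Lemma idempotent_factor n (P : 'M[F]_n) : P *m P = P ->
  exists (C : 'M_(n, \rank P)) (D : 'M_(\rank P, n)), C *m D = P /\ D *m C = 1%:M.
Proof.
move=> PP; exists (col_base P), (row_base P); split; first exact: mulmx_base.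
have := row_base_free P; have := col_base_full P; have := mulmx_base P.
move: (col_base P) (row_base P) => C D CD Cfull Dfree.
apply: (row_free_inj Dfree); apply: (row_full_inj Cfull).
by rewrite mul1mx -mulmxA CD mulmxA CD.
Qed.

Lemma idempotent_trace n (P : 'M[F]_n) : P *m P = P -> \tr P = (\rank P)%:R.
Proof.
move=> /idempotent_factor [C [D [CD DC]]].
by rewrite -{1}CD mxtrace_mulC DC mxtrace1.
Qed.

(** In characteristic zero equal traces mean equal ranks, so both idempotents factor through the
    same space; exchanging the factors gives [X] and [Y]. *)
Lemma idempotent_equiv m n (P : 'M[F]_m) (Q : 'M[F]_n) :
  P *m P = P -> Q *m Q = Q -> \tr P = \tr Q ->
  exists (X : 'M_(m, n)) (Y : 'M_(n, m)),
    [/\ X *m Y = P, Y *m X = Q, P *m X = X /\ X *m Q = X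
      & Q *m Y = Y /\ Y *m P = Y].
Proof.
move=> PP QQ; rewrite !idempotent_trace // => /eqP; rewrite eqr_nat => /eqP.
case: (idempotent_factor PP) => C [D []]; case: (idempotent_factor QQ) => C' [D' []].
move: C D C' D'; move: (\rank P) (\rank Q) => a b C D C' D' e' f' e f ab.
subst b; exists (C *m D'), (C' *m D).
have cancel p q t (M : 'M[F]_(p, a)) (N : 'M[F]_(a, q)) (S : 'M[F]_(q, a))
    (T : 'M[F]_(a, t)) : N *m S = 1%:M -> M *m N *m (S *m T) = M *m T.
  by move=> NS; rewrite mulmxA -(mulmxA M) NS mulmx1.
by rewrite -e -e' !cancel.
Qed.

(** The conjugating matrices are the sums of the partial equivalences between [p i] and [q i]. *)
Lemma orthogonal_idempotents_conj (I : finType) m n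
    (p : I -> 'M[F]_m) (q : I -> 'M[F]_n) :
  (forall i j, p i *m p j = if i == j then p i else 0) -> \sum_i p i = 1%:M ->
  (forall i j, q i *m q j = if i == j then q i else 0) -> \sum_i q i = 1%:M ->
  (forall i, \tr (p i) = \tr (q i)) ->
  exists (X : 'M_(m, n)) (Y : 'M_(n, m)),
    [/\ X *m Y = 1%:M, Y *m X = 1%:M & forall i, p i *m X = X *m q i].
Proof.
move=> pp p1 qq q1 tr_pq.
have /fin_all_exists [x /fin_all_exists [y xyP]] : forall i,
    exists (X : 'M_(m, n)) (Y : 'M_(n, m)), [/\ X *m Y = p i, Y *m X = q i,
      p i *m X = X /\ X *m q i = X & q i *m Y = Y /\ Y *m p i = Y].
  by move=> i; apply: idempotent_equiv; rewrite ?pp ?qq ?eqxx.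
(* Cross terms vanish: [f i] absorbs [r i] and [g j] absorbs [r j], and [r i *m r j] is zero for
   distinct indices. *)
have mul_sumr a b c (r : I -> 'M[F]_b) (f : I -> 'M_(a, b)) (g : I -> 'M_(b, c)) :
    (forall i j, r i *m r j = if i == j then r i else 0) ->
    (forall i, f i *m r i = f i) -> (forall i, r i *m g i = g i) ->
    forall i, f i *m (\sum_j g j) = f i *m g i.
  move=> rr fr rg i; rewrite mulmx_sumr (bigD1 i) //= big1 ?addr0 // => j ji.
  by rewrite -(fr i) -(rg j) mulmxA -(mulmxA (f i)) rr eq_sym (negPf ji) mulmx0 mul0mx.
have mul_suml a b c (r : I -> 'M[F]_b) (f : I -> 'M_(a, b)) (g : I -> 'M_(b, c)) :
    (forall i j, r i *m r j = if i == j then r i else 0) ->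
    (forall i, f i *m r i = f i) -> (forall i, r i *m g i = g i) ->
    forall i, (\sum_j f j) *m g i = f i *m g i.
  move=> rr fr rg i; rewrite mulmx_suml (bigD1 i) //= big1 ?addr0 // => j ji.
  by rewrite -(fr j) -(rg i) mulmxA -(mulmxA (f j)) rr (negPf ji) mulmx0 mul0mx.
exists (\sum_i x i), (\sum_i y i); split.
- rewrite mulmx_suml -p1; apply: eq_bigr => i _.
  rewrite (mul_sumr _ _ _ q) // => [|j|j]; first by have [] := xyP i.
    by have [_ _ []] := xyP j.
  by have [_ _ _ []] := xyP j.
- rewrite mulmx_suml -q1; apply: eq_bigr => i _.
  rewrite (mul_sumr _ _ _ p) // => [|j|j]; first by have [] := xyP i.
    by have [_ _ _ []] := xyP j.
  by have [_ _ []] := xyP j.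
- move=> i; rewrite (mul_sumr _ _ _ p) ?(mul_suml _ _ _ q) //; first 1 last.
  + by move=> j; have [_ _ [_ ]] := xyP j.
  + by move=> j; rewrite qq eqxx.
  + by move=> j; rewrite pp eqxx.
  + by move=> j; have [_ _ []] := xyP j.
  by have [_ _ [-> ->]] := xyP i.
Qed.

(** The gaps [P0], [P1 - P0], [1 - P1] form a complete orthogonal system. The equality [m = n] is a
    hypothesis because the dimensions will be cardinals of two different types. *)
Lemma nested_idempotents_conj m n (P0 P1 : 'M[F]_m) (Q0 Q1 : 'M[F]_n) :
  m = n ->
  P0 *m P0 = P0 -> P1 *m P1 = P1 -> P0 *m P1 = P0 -> P1 *m P0 = P0 ->
  Q0 *m Q0 = Q0 -> Q1 *m Q1 = Q1 -> Q0 *m Q1 = Q0 -> Q1 *m Q0 = Q0 ->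
  \tr P0 = \tr Q0 -> \tr P1 = \tr Q1 ->
  exists (X : 'M_(m, n)) (Y : 'M_(n, m)),
    [/\ X *m Y = 1%:M, Y *m X = 1%:M, P0 *m X = X *m Q0 & P1 *m X = X *m Q1].
Proof.
move=> mn; subst n => P00 P11 P01 P10 Q00 Q11 Q01 Q10 t0 t1.
pose gaps (S0 S1 : 'M[F]_m) (i : option bool) :=
  match i with None => S0 | Some true => S1 - S0 | Some false => 1%:M - S1 end.
have gapsM S0 S1 : S0 *m S0 = S0 -> S1 *m S1 = S1 -> S0 *m S1 = S0 -> S1 *m S0 = S0 ->
    forall i j, gaps S0 S1 i *m gaps S0 S1 j = if i == j then gaps S0 S1 i else 0.
  move=> S00 S11 S01 S10 [[]|] [[]|] /=;
  by rewrite ?mulmxBl ?mulmxBr ?mulmxBl ?mulmxBr ?mulmx1 ?mul1mx ?S00 ?S11 ?S01 ?S10 ?subrr ?subr0.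
have gaps1 S0 S1 : \sum_i gaps S0 S1 i = 1%:M.
  rewrite (bigD1 None) //= (bigD1 (Some true)) //= (bigD1 (Some false)) //= big1.
    by rewrite addr0 addrA (addrC S0) subrK addrC subrK.
  by case=> [[]|].
have [|X [Y [XY YX PX]]] := orthogonal_idempotents_conj
  (gapsM _ _ P00 P11 P01 P10) (gaps1 P0 P1) (gapsM _ _ Q00 Q11 Q01 Q10) (gaps1 Q0 Q1).
  by case=> [[]|] /=; rewrite ?linearB /= ?t0 ?t1.
exists X, Y; split=> //; first exact: (PX None).
by rewrite -(subrK P0 P1) -(subrK Q0 Q1) mulmxDl mulmxDr (PX (Some true)) (PX None).
Qed.

End Idempotents.

(** Right multiplication by [P] sends row eigenvectors of [L] to those of [M], injectively since [P]
    has a right inverse. *)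
Lemma eigenspace_rank_le (F : fieldType) m n (L : 'M[F]_m) (M : 'M[F]_n)
    (P : 'M_(m, n)) (Q : 'M_(n, m)) l :
  P *m Q = 1%:M -> L *m P = P *m M ->
  (\rank (eigenspace L l) <= \rank (eigenspace M l))%N.
Proof.
move=> PQ LP; rewrite -(@mxrankMfree _ _ _ _ (eigenspace L l) P).
  apply/mxrankS/eigenspaceP; rewrite -mulmxA -LP mulmxA.
  have /eigenspaceP -> : (eigenspace L l <= eigenspace L l)%MS by [].
  by rewrite scalemxAl.
by apply/row_freeP; exists Q.
Qed.

Lemma eigenspace_rank_conj (F : fieldType) m n (L : 'M[F]_m) (M : 'M[F]_n)
    (P : 'M_(m, n)) (Q : 'M_(n, m)) l :
  P *m Q = 1%:M -> Q *m P = 1%:M -> L *m P = P *m M ->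
  \rank (eigenspace L l) = \rank (eigenspace M l).
Proof.
move=> PQ QP LP; apply/eqP; rewrite eqn_leq (eigenspace_rank_le _ PQ LP) /=.
apply: (eigenspace_rank_le _ QP).
by rewrite -[LHS]mul1mx -QP -mulmxA (mulmxA P) -LP -(mulmxA L) PQ mulmx1.
Qed.

(** [D M Q] is the compression of [M] to the image of the projection [Q D]. As [U] intertwines the
    projections as well as [M] and [M'], the matrices [D U Q'] and [D' U' Q] are mutually inverse
    and intertwine the compressions. *)
Lemma compression_conj (F : fieldType) n n' N N' (D : 'M[F]_(n, N)) (Q : 'M_(N, n))
    (D' : 'M[F]_(n', N')) (Q' : 'M_(N', n')) (M : 'M_N) (M' : 'M_N')
    (U : 'M_(N, N')) (U' : 'M_(N', N)) l :
  D *m Q = 1%:M -> D' *m Q' = 1%:M -> U *m U' = 1%:M -> U' *m U = 1%:M ->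
  (Q *m D) *m U = U *m (Q' *m D') -> M *m U = U *m M' ->
  \rank (eigenspace (D *m M *m Q) l) = \rank (eigenspace (D' *m M' *m Q') l).
Proof.
move=> DQ DQ' UU' U'U QDU MU.
have QDU' : (Q' *m D') *m U' = U' *m (Q *m D).
  by rewrite -[LHS]mul1mx -U'U -mulmxA (mulmxA U) -QDU -(mulmxA (Q *m D)) UU' mulmx1.
apply: (@eigenspace_rank_conj _ _ _ _ _ (D *m U *m Q') (D' *m U' *m Q)).
- rewrite -!mulmxA (mulmxA Q') (mulmxA _ U') QDU' !mulmxA -(mulmxA D) UU' mulmx1.
  by rewrite DQ mul1mx DQ.
- rewrite -!mulmxA (mulmxA Q) (mulmxA _ U) QDU !mulmxA -(mulmxA D') U'U mulmx1.
  by rewrite DQ' mul1mx DQ'.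
(* Each side loses its projection through [D (Q D) = D] or [(Q' D') Q' = Q']; what remains is
   [D M U Q' = D U M' Q']. *)
- have -> : D *m M *m Q *m (D *m U *m Q') = D *m M *m (Q *m D *m U) *m Q'.
    by rewrite !mulmxA.
  have -> : D *m U *m Q' *m (D' *m M' *m Q') = D *m (U *m (Q' *m D')) *m M' *m Q'.
    by rewrite !mulmxA.
  rewrite -QDU; have -> : D *m (Q *m D *m U) = D *m U by rewrite !mulmxA DQ mul1mx.
  rewrite QDU; have -> : D *m M *m (U *m (Q' *m D')) *m Q' = D *m (M *m U) *m Q'.
    by rewrite -!mulmxA DQ' mulmx1.
  by rewrite MU !mulmxA.
Qed.

(** * Matrices indexed by finite types *)

Section Kernels.

Variable F : numFieldType.

Definition kmx (S T : finType) (k : S -> T -> F) : 'M_(#|S|, #|T|) :=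
  \matrix_(i, j) k (enum_val i) (enum_val j).

Lemma eq_kmx (S T : finType) (k l : S -> T -> F) : k =2 l -> kmx k = kmx l.
Proof. by move=> kl; apply/matrixP => i j; rewrite !mxE. Qed.

Lemma sum_enum_val (T : finType) (f : T -> F) : \sum_(i < #|T|) f (enum_val i) = \sum_x f x.
Proof. by rewrite [RHS](reindex _ (onW_bij _ (enum_val_bij T))). Qed.

Lemma kmxM (S T U : finType) (k : S -> T -> F) (l : T -> U -> F) :
  kmx k *m kmx l = kmx (fun x z => \sum_y k x y * l y z).
Proof.
apply/matrixP => i j; rewrite !mxE -[RHS]sum_enum_val.
by apply: eq_bigr => a _; rewrite !mxE.
Qed.

Lemma kmx1 (T : finType) : kmx (fun x y : T => (x == y)%:R) = 1%:M.
Proof. by apply/matrixP => i j; rewrite !mxE (inj_eq enum_val_inj). Qed.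

Lemma kmx_trace (T : finType) (k : T -> T -> F) : \tr (kmx k) = \sum_x k x x.
Proof. by rewrite -[RHS]sum_enum_val; apply: eq_bigr => i _; rewrite mxE. Qed.

Lemma sum_delta (T : finType) (a : T) (f : T -> F) :
  \sum_x (a == x)%:R * f x = f a.
Proof.
rewrite (bigD1 a) //= eqxx mul1r big1 ?addr0 // => x xa.
by rewrite eq_sym (negPf xa) mul0r.
Qed.

(** Block diagonal over [V]. The blocks are indexed by ordinals, the form in which the conjugating
    matrices are obtained, hence [enum_rank]. *)
Definition blkmx (V S T : finType) (f : V -> 'M[F]_(#|S|, #|T|)) :=
  kmx (fun (p : V * S) (q : V * T) =>
    (p.1 == q.1)%:R * f p.1 (enum_rank p.2) (enum_rank q.2)).

Lemma eq_blkmx (V S T : finType) (f g : V -> 'M[F]_(#|S|, #|T|)) :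
  f =1 g -> blkmx f = blkmx g.
Proof. by move=> fg; apply: eq_kmx => p q; rewrite fg. Qed.

Lemma blkmxM (V S T U : finType) (f : V -> 'M[F]_(#|S|, #|T|))
    (g : V -> 'M[F]_(#|T|, #|U|)) :
  blkmx f *m blkmx g = blkmx (fun v => f v *m g v).
Proof.
rewrite kmxM; apply: eq_kmx => -[v s] [w u] /=.
rewrite -(pair_bigA _ (fun a b => (v == a)%:R * f v (enum_rank s) (enum_rank b) *
  ((a == w)%:R * g a (enum_rank b) (enum_rank u)))) /=.
rewrite (eq_bigr (fun a => (v == a)%:R * \sum_b ((a == w)%:R *
   (f v (enum_rank s) (enum_rank b) * g a (enum_rank b) (enum_rank u))))).
  rewrite sum_delta -mulr_sumr mxE; congr (_ * _); rewrite -[LHS]sum_enum_val.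
  by apply: eq_bigr => i _; rewrite enum_valK.
move=> a _; rewrite mulr_sumr; apply: eq_bigr => b _.
by rewrite -!mulrA; congr (_ * _); rewrite mulrCA.
Qed.

Lemma blkmx1 (V S : finType) : blkmx (fun _ : V => 1%:M : 'M_(#|S|)) = 1%:M.
Proof.
rewrite -[RHS]kmx1; apply: eq_kmx => -[v s] [w t] /=.
by rewrite mxE (inj_eq enum_rank_inj) -natrM mulnb -xpair_eqE.
Qed.

(** The Kronecker product of [m] with the identity on [S]. *)
Definition ampmx (V : finType) (m : V -> V -> F) (S : finType) :=
  kmx (fun p q : V * S => m p.1 q.1 * (p.2 == q.2)%:R).

(** Both products have the entries [m v w * U s t]: the two factors act on different coordinates. *)
Lemma ampmx_blkmx (V S T : finType) (m : V -> V -> F) (U : 'M[F]_(#|S|, #|T|)) :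
  ampmx m S *m blkmx (fun _ : V => U) = blkmx (fun _ : V => U) *m ampmx m T.
Proof.
rewrite !kmxM; apply: eq_kmx => -[v s] [w t] /=.
transitivity (m v w * U (enum_rank s) (enum_rank t)).
  rewrite (bigD1 (w, s)) //= !eqxx mulr1 mul1r big1 ?addr0 // => -[w' s'] /=.
  rewrite xpair_eqE negb_and => /orP[] /negPf ne; first by rewrite ne mul0r mulr0.
  by rewrite eq_sym ne mulr0 mul0r.
rewrite (bigD1 (v, t)) //= !eqxx mulr1 mul1r big1 ?addr0 1?mulrC // => -[w' s'] /=.
rewrite xpair_eqE negb_and => /orP[] /negPf ne; last by rewrite ne !mulr0.
by rewrite eq_sym ne !mul0r.
Qed.

(** * Averaging over the fibres of a surjection *)

Section Fibres.

Variables (T X : finType) (q : T -> X).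
Hypothesis q_surj : forall x, exists t, q t = x.

Definition fibre_card (x : X) := #|[set t | q t == x]|.

Lemma fibre_card_gt0 x : (0 < fibre_card x)%N.
Proof. by have [t <-] := q_surj x; apply/card_gt0P; exists t; rewrite inE. Qed.

Lemma fibre_card_neq0 x : (fibre_card x)%:R != 0 :> F.
Proof. by rewrite pnatr_eq0 -lt0n fibre_card_gt0. Qed.

Lemma sum_fibre_const x (c : F) : \sum_(t | q t == x) c = c * (fibre_card x)%:R.
Proof.
by rewrite mulr_natr -sumr_const; apply: eq_bigl => t; rewrite inE.
Qed.

(** On column vectors, composition with [q] and the mean over each fibre. *)
Definition pullmx := kmx (fun t x => (q t == x)%:R).
Definition avgmx := kmx (fun x t => (q t == x)%:R / (fibre_card x)%:R).

Lemma avgmx_pullmx : avgmx *m pullmx = 1%:M.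
Proof.
rewrite -kmx1 kmxM; apply: eq_kmx => x y.
have -> : (x == y)%:R = \sum_(t | q t == x) (x == y)%:R / (fibre_card x)%:R :> F.
  by rewrite sum_fibre_const divfK // fibre_card_neq0.
rewrite [RHS]big_mkcond /=; apply: eq_bigr => t _.
by case: eqP => [->|_]; rewrite ?mul0r // mul1r mulrC.
Qed.

Lemma pullmx_avgmx :
  pullmx *m avgmx = kmx (fun t u => (q t == q u)%:R / (fibre_card (q t))%:R).
Proof.
rewrite kmxM; apply: eq_kmx => t u.
by rewrite sum_delta eq_sym.
Qed.

Lemma sum_fibre_avg (f : X -> F) : \sum_x f x = \sum_t f (q t) / (fibre_card (q t))%:R.
Proof.
rewrite (partition_big q predT) //=; apply: eq_bigr => x _.
rewrite (eq_bigr (fun=> f x / (fibre_card x)%:R)) => [|t /eqP-> //].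
by rewrite sum_fibre_const divfK // fibre_card_neq0.
Qed.

End Fibres.

End Kernels.

(** * Laplacians of glued copies *)

Local Open Scope complex_scope.

Definition hop (R : realType) (G : mgraph R) (e : edge G) : R[i] :=
  (wt e)%:C * expi (pot e).

Definition lapk (R : realType) (G : mgraph R) (v w : vert G) : R[i] :=
  (v == w)%:R - ((degw v)^-1)%:C * \sum_(e in Ev v | tgt e == w) hop e.

Lemma lap_kmx (R : realType) (G : mgraph R) : lap G = kmx (@lapk R G).
Proof. by apply/matrixP => i j; rewrite !mxE /lapk (inj_eq enum_val_inj). Qed.

(* The fibres of [q] are the sets of vertices of [G * K] that are glued together. *)
Record glued_copies (R : realType) (G H : mgraph R) (K : finType)
    (q : vert G * K -> vert H) (ed : edge G * K -> edge H) : Prop := GluedCopies {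
  glue_surj : forall x, exists t, q t = x;
  glue_fst : forall t u, q t = q u -> t.1 = u.1;
  glue_edge_bij : bijective ed;
  glue_src : forall p, src (ed p) = q (src p.1, p.2);
  glue_tgt : forall p, tgt (ed p) = q (tgt p.1, p.2);
  glue_wt : forall p, wt (ed p) = wt p.1;
  glue_pot : forall p, pot (ed p) = pot p.1 }.

Section GluedCopies.

Variables (R : realType) (G H : mgraph R) (K : finType).
Variables (q : vert G * K -> vert H) (ed : edge G * K -> edge H).
Hypothesis glued : glued_copies q ed.

Lemma sum_edge_copies (W : nmodType) (f : edge G -> W) (P : pred (edge G * K)) :
  \sum_(p | P p) f p.1 =
  \sum_(t : vert G * K) \sum_(e | (src e == t.1) && P (e, t.2)) f e.
Proof.
rewrite (partition_big (fun p : edge G * K => (src p.1, p.2)) predT) //=.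
apply: eq_bigr => -[v k] _ /=.
rewrite (reindex_omap (fun e => (e, k)) (fun p => if p.2 == k then Some p.1 else None)) /=.
  apply: eq_bigl => e; rewrite xpair_eqE !eqxx !andbT.
  by rewrite andbC.
by move=> [e k'] /=; rewrite xpair_eqE => /andP[_ /andP[_ /eqP ->]]; rewrite eqxx.
Qed.

(** The edges leaving a glued vertex are those leaving the points of its fibre. [P] constrains the
    head: trivially for degrees, to a given vertex for the Laplacian. *)
Lemma sum_edge_glued (W : nmodType) (f : edge H -> W) (g : edge G -> W)
    (x : vert H) (P : pred (vert H)) :
  (forall p, f (ed p) = g p.1) ->
  \sum_(e in Ev x | P (tgt e)) f e =
  \sum_(t | q t == x) \sum_(e in Ev t.1 | P (q (tgt e, t.2))) g e.
Proof.
move=> fg; rewrite (reindex _ (onW_bij _ (glue_edge_bij glued))) /=.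
rewrite (eq_bigl (fun p : edge G * K => (q (src p.1, p.2) == x) && P (q (tgt p.1, p.2)))).
  rewrite (eq_bigr (fun p : edge G * K => g p.1)) //.
  rewrite sum_edge_copies [RHS]big_mkcond /=; apply: eq_bigr => -[v k] _ /=.
  case: ifP => qx; last by rewrite big1 // => e /andP[/eqP->]; rewrite qx.
  by apply: eq_bigl => e; rewrite inE; case: eqP => //= ->; rewrite qx.
by move=> p; rewrite inE (glue_src glued) (glue_tgt glued).
Qed.

(** A fibre consists of copies of one vertex of [G], each bringing the same weighted degree. *)
Lemma degw_glued t : degw (q t) = degw t.1 * (fibre_card q (q t))%:R.
Proof.
rewrite /degw -sum_fibre_const.
transitivity (\sum_(e in Ev (q t) | predT (tgt e)) wt e).
  by apply: eq_bigl => e; rewrite andbT.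
rewrite (sum_edge_glued (g := @wt R G) _ _ (glue_wt glued)).
apply: eq_bigr => u /eqP/(glue_fst glued) <-.
by apply: eq_bigl => e; rewrite andbT.
Qed.

(** The degree of a glued vertex carries its fibre size as a factor, so dividing by it turns the sum
    over the fibre into an average. *)
Lemma lap_glued : lap H = avgmx _ q *m ampmx (@lapk R G) K *m pullmx _ q.
Proof.
rewrite lap_kmx -mulmxA !kmxM; apply: eq_kmx => x y.
(* The Laplacian of [G], applied within the copy of [t] to the pull-back of the indicator of [y]. *)
have inner (t : vert G * K) :
    \sum_u lapk t.1 u.1 * (t.2 == u.2)%:R * (q u == y)%:R =
    (q t == y)%:R - ((degw t.1)^-1)%:C *
      \sum_(e in Ev t.1 | q (tgt e, t.2) == y) hop e.
  case: t => v k /=.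
  transitivity (\sum_w \sum_j lapk v w * (k == j)%:R * (q (w, j) == y)%:R).
    by rewrite pair_bigA; apply: eq_bigr => -[w j].
  transitivity (\sum_w lapk v w * (q (w, k) == y)%:R).
    apply: eq_bigr => w _; rewrite -[RHS](sum_delta k (fun j => lapk v w * (q (w, j) == y)%:R)).
    by apply: eq_bigr => j _; rewrite -mulrA mulrCA.
  transitivity (\sum_w ((v == w)%:R * (q (w, k) == y)%:R - ((degw v)^-1)%:C *
      ((\sum_(e in Ev v | tgt e == w) hop e) * (q (w, k) == y)%:R))).
    by apply: eq_bigr => w _; rewrite /lapk mulrBl mulrA.
  rewrite sumrB sum_delta; congr (_ - _).
  rewrite -mulr_sumr; congr (_ * _).
  rewrite [RHS](partition_big (@tgt R G) predT) //=; apply: eq_bigr => w _.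
  case: (boolP (q (w, k) == y)) => [qy|/negPf qy]; rewrite ?mulr1 ?mulr0; last first.
    by rewrite big1 // => e /andP[/andP[_ qe] /eqP te]; rewrite -te qe in qy.
  apply: eq_bigl => e; rewrite -andbA; congr (_ && _).
  by case: eqP => [->|_]; rewrite ?qy ?andbF.
under eq_bigr do rewrite inner.
rewrite (eq_bigr (fun t => if q t == x then (x == y)%:R / (fibre_card q x)%:R
  - ((degw x)^-1)%:C * \sum_(e in Ev t.1 | q (tgt e, t.2) == y) hop e else 0)); last first.
  move=> t _; case: eqP => [<-|]; last by rewrite !mul0r.
  rewrite degw_glued invfM rmorphM /= !fmorphV rmorph_nat mulrBr mul1r.
  by congr (_ - _); [rewrite mulrC | rewrite mulrA (mulrC _^-1)].
rewrite -big_mkcond sumrB sum_fibre_const divfK; last first.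
  exact: fibre_card_neq0 (glue_surj glued) _.
rewrite -mulr_sumr /lapk (sum_edge_glued (g := @hop R G) x (fun z => z == y)) // => p.
by rewrite /hop (glue_wt glued) (glue_pot glued).
Qed.

End GluedCopies.

(** * Contracted unions of frame members *)

Lemma cls_eqE (T : finType) (e : rel T) : equivalence_rel e ->
  forall x y, (cls e x == cls e y) = e x y.
Proof.
move=> eqve x y; rewrite -val_eqE /=; apply/eqP/idP => [/setP/(_ y)|exy].
  by rewrite !inE (eqve y y y) => ->.
by apply/setP => z; rewrite !inE; apply: (eqve x y z).2.
Qed.

Lemma cls_surj (T : finType) (e : rel T) (X : cvert e) : exists x, cls e x = X.
Proof.
by case: X => X /[dup] /imsetP[x _ ->] Xe; exists x; apply/val_inj.
Qed.

Section Cfunion.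

Variables (R : realType) (G : mgraph R) (V0 V1 : {set vert G}) (A : seq nat).

Definition copies : finType := {i : 'I_(size A) & 'I_(nth 0%N A i)}.

(** Neither contraction merges copies of different vertices of [G], so the whole gluing is a family
    of relations on [copies], one for each [v]. *)
Definition glued_at (v : vert G) (k l : copies) : bool :=
  [|| k == l, (v \in V0) && (tag k == tag l) | v \in V1].

Definition funion_cls (t : vert G * copies) : funion_vert V0 A :=
  Tagged (fun i : 'I_(size A) => vert (frame V0 (nth 0%N A i)))
    (cls (frame_rel V0 (nth 0%N A (tag t.2))) (t.1, tagged t.2)).

Lemma frame_rel_equiv a : equivalence_rel (frame_rel V0 a).
Proof.
move=> [v i] [w j] [u k]; rewrite /frame_rel /= !xpair_eqE !eqxx; split=> //=.
case: (v =P w) => //= <-; case: (v == u) => //=.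
by case: (v \in V0); rewrite ?orbT // !orbF => /eqP->.
Qed.

Lemma funion_cls_surj x : exists t, funion_cls t = x.
Proof.
case: x => i x; have [[v j] <-] := cls_surj x.
by exists (v, Tagged (fun i : 'I_(size A) => 'I_(nth 0%N A i)) j).
Qed.

Lemma is_cls_of_funion_cls v t : is_cls_of v (funion_cls t) = (t.1 == v).
Proof.
case: t => w [i j] /=; apply/existsP/eqP => /= [[k]|<-]; last first.
  by exists j; rewrite inE (frame_rel_equiv (w, j) (w, j) (w, j)).1.
by rewrite inE => /orP[/eqP[]|/andP[/eqP]].
Qed.

Lemma funion_rel_cls t u :
  funion_rel V0 V1 A (funion_cls t) (funion_cls u) = (t.1 == u.1) && glued_at t.1 t.2 u.2.
Proof.
have -> : funion_rel V0 V1 A (funion_cls t) (funion_cls u) =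
    (funion_cls t == funion_cls u) || ((t.1 == u.1) && (t.1 \in V1)).
  congr (_ || _); apply/existsP/andP => [[v]|[/eqP tu t1]].
    by rewrite !is_cls_of_funion_cls => /and3P[v1 /eqP-> /eqP->].
  by exists t.1; rewrite !is_cls_of_funion_cls tu eqxx -tu t1.
case: t u => [v [i j]] [w [i' j']]; rewrite /glued_at /=.
case: (i =P i') => [ii'|ne]; last first.
  have /negPf-> : funion_cls (v, existT _ i j) != funion_cls (w, existT _ i' j').
    by apply/eqP => -[].
  have /negPf-> : existT _ i j != existT _ i' j' :> copies by apply/eqP => -[].
  by rewrite andbF.
case: i' / ii' j' => j'; rewrite /funion_cls /= !eq_Tagged /= cls_eqE; last exact: frame_rel_equiv.
rewrite /frame_rel xpair_eqE /= andbT.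
by case: (v == w) => //=; rewrite orbA.
Qed.

Lemma funion_rel_equiv : equivalence_rel (funion_rel V0 V1 A).
Proof.
move=> x y z; have [t <-] := funion_cls_surj x; have [u <-] := funion_cls_surj y.
have [s <-] := funion_cls_surj z; rewrite !funion_rel_cls.
case: t u s => [v k] [w l] [u m]; rewrite /glued_at /= !eqxx; split=> //=.
case: (v =P w) => //= <-; case: (v == u) => //=.
case: (v \in V1); rewrite ?orbT // !orbF.
case: (v \in V0) => /=; rewrite ?orbF; last by move/eqP->.
have tag_eq (a b : copies) : (a == b) || (tag a == tag b) = (tag a == tag b).
  by case: eqP => //= ->; rewrite eqxx.
by rewrite !tag_eq => /eqP->.
Qed.

Definition cfunion_cls (t : vert G * copies) : vert (cfunion V0 V1 A) :=
  cls (funion_rel V0 V1 A) (funion_cls t).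

Definition cfunion_edge (p : edge G * copies) : edge (cfunion V0 V1 A) :=
  Tagged (fun i : 'I_(size A) => edge (frame V0 (nth 0%N A i))) (p.1, tagged p.2).

Lemma cfunion_cls_eq t u :
  (cfunion_cls t == cfunion_cls u) = (t.1 == u.1) && glued_at t.1 t.2 u.2.
Proof. by rewrite cls_eqE ?funion_rel_cls //; apply: funion_rel_equiv. Qed.

(** Contraction keeps all edges, so the edge bijection only regroups the indices; sources, targets,
    weights and potentials agree by computation. *)
Lemma cfunion_glued : glued_copies cfunion_cls cfunion_edge.
Proof.
split=> //.
- move=> x; have [y <-] := cls_surj x; have [t <-] := funion_cls_surj y.
  by exists t.
- by move=> t u /eqP; rewrite cfunion_cls_eq => /andP[/eqP].
- exists (fun e => ((tagged e).1,
    Tagged (fun i : 'I_(size A) => 'I_(nth 0%N A i)) (tagged e).2)).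
    by case=> e [i j].
  by case=> i [e j].
Qed.

End Cfunion.

(** * Sizes of the gluing classes *)

Section CfunionSums.

Variables (R : realType) (G : mgraph R) (V0 V1 : {set vert G}) (A : seq nat).

Notation C := (copies A).
Notation block_size k := (nth 0%N A (tag k)).

Lemma sum_copies (W : nmodType) (f : C -> W) :
  \sum_k f k = \sum_(i < size A) \sum_(j < nth 0%N A i)
    f (Tagged (fun i : 'I_(size A) => 'I_(nth 0%N A i)) j).
Proof. by rewrite sig_big_dep; apply: eq_bigr => -[i j]. Qed.

Lemma card_block (k : C) : #|[set l : C | tag k == tag l]| = block_size k.
Proof.
case: k => i j /=.
have Tagged_inj :
    injective (Tagged (i := i) (fun i : 'I_(size A) => 'I_(nth 0%N A i))).
  by move=> a b /eqP; rewrite eq_Tagged => /eqP.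
rewrite -[RHS]card_ord -cardsT -(card_imset _ Tagged_inj).
apply: eq_card => -[i' j']; rewrite inE /=; apply/eqP/imsetP => [ii'|[j'' _ /(congr1 tag)] //].
by case: i' / ii' j' => j'; exists j'.
Qed.

Lemma block_size_gt0 (k : C) : (0 < block_size k)%N.
Proof. by rewrite -card_block; apply/card_gt0P; exists k; rewrite inE. Qed.

Lemma card_copies : #|C| = sumn A.
Proof.
rewrite -sum1_card sumnE (big_nth 0%N) big_mkord.
transitivity (\sum_(i < size A) \sum_(j < nth 0%N A i) 1)%N.
  exact: (sum_copies (fun=> 1%N)).
by apply: eq_bigr => i _; rewrite sum1_card card_ord.
Qed.

Lemma fibre_card_cfunion v k :
  fibre_card (@cfunion_cls R G V0 V1 A) (cfunion_cls V0 V1 (v, k)) =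
  if v \in V1 then sumn A else if v \in V0 then block_size k else 1%N.
Proof.
have -> : fibre_card (@cfunion_cls R G V0 V1 A) (cfunion_cls V0 V1 (v, k)) =
    #|[set l | glued_at V0 V1 v k l]|.
  rewrite -(card_imset _ (fun a b (e : (v, a) = (v, b)) => congr1 snd e)).
  apply: eq_card => -[w l]; rewrite inE eq_sym cfunion_cls_eq /=.
  apply/andP/imsetP => [[/eqP-> kl]|[l' + [-> ->]]]; last by rewrite inE.
  by exists l; rewrite ?inE.
rewrite /glued_at; case: (v \in V1).
  by rewrite -card_copies; apply: eq_card => l; rewrite !inE !orbT.
case: (v \in V0); rewrite /= -?card_block.
  apply: eq_card => l; rewrite !inE orbF.
  by case: eqP => //= ->; rewrite eqxx.
by rewrite -(cards1 k); apply: eq_card => l; rewrite !inE !orbF eq_sym.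
Qed.

End CfunionSums.

(** * Averages over all copies and over single frame members *)

Section BlockAveraging.

Variables (F : numFieldType) (A : seq nat).

Notation C := (copies A).
Notation block_size k := (nth 0%N A (tag k)).

Definition total_avg : 'M[F]_#|C| := kmx (fun _ _ : C => (sumn A)%:R^-1).
Definition block_avg : 'M[F]_#|C| :=
  kmx (fun k l : C => (tag k == tag l)%:R / (block_size k)%:R).

Lemma sum_block (k : C) (f : C -> F) : (forall l, tag k = tag l -> f l = f k) ->
  \sum_l (tag k == tag l)%:R * f l = (block_size k)%:R * f k.
Proof.
move=> fk; rewrite -card_block mulr_natl -sumr_const [RHS]big_mkcond.
apply: eq_bigr => l _; rewrite inE; case: eqP => [/fk->|_]; first by rewrite mul1r.
by rewrite mul0r.
Qed.

Lemma block_size_neq0 (k : C) : (block_size k)%:R != 0 :> F.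
Proof. by rewrite pnatr_eq0 -lt0n block_size_gt0. Qed.

Lemma sumn_neq0 (k : C) : (sumn A)%:R != 0 :> F.
Proof. by rewrite pnatr_eq0 -lt0n -card_copies; apply/card_gt0P; exists k. Qed.

Lemma total_avg_idem : total_avg *m total_avg = total_avg.
Proof.
rewrite kmxM; apply: eq_kmx => k l.
by rewrite sumr_const card_copies -[LHS]mulr_natr divfK // sumn_neq0.
Qed.

Lemma block_avg_idem : block_avg *m block_avg = block_avg.
Proof.
rewrite kmxM; apply: eq_kmx => k l.
under eq_bigr do rewrite -mulrA.
rewrite sum_block => [|m ->//].
by rewrite mulrA mulfV ?mul1r ?block_size_neq0.
Qed.

Lemma total_block_avg : total_avg *m block_avg = total_avg.
Proof.
rewrite kmxM; apply: eq_kmx => k l; rewrite -mulr_sumr.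
rewrite (eq_bigr (fun m => (tag l == tag m)%:R * (block_size m)%:R^-1)); last first.
  by move=> m _; rewrite eq_sym.
by rewrite sum_block => [|m ->//]; rewrite mulfV ?mulr1 ?block_size_neq0.
Qed.

Lemma block_total_avg : block_avg *m total_avg = total_avg.
Proof.
rewrite kmxM; apply: eq_kmx => k l.
under eq_bigr do rewrite -mulrA.
by rewrite sum_block // mulrA mulfV ?mul1r ?block_size_neq0.
Qed.

Lemma total_avg_trace : (0 < sumn A)%N -> \tr total_avg = 1.
Proof.
move=> A0; rewrite kmx_trace sumr_const card_copies -[LHS]mulr_natr mulVf //.
by rewrite pnatr_eq0 -lt0n.
Qed.

(** Every frame member contributes trace one, provided that it is nonempty. *)
Lemma block_avg_trace : all (fun a => 0 < a)%N A -> \tr block_avg = (size A)%:R.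
Proof.
move=> /(all_nthP 0%N) A0; rewrite kmx_trace sum_copies.
rewrite -[X in X%:R]card_ord -sumr_const; apply: eq_bigr => i _ /=.
by rewrite eqxx mul1r sumr_const card_ord -[LHS]mulr_natr mulVf // pnatr_eq0 -lt0n A0.
Qed.

End BlockAveraging.

(** * Isospectrality *)

Lemma pullmx_avgmx_cfunion (F : numFieldType) (R : realType) (G : mgraph R)
    (V0 V1 : {set vert G}) (A : seq nat) :
  pullmx F (@cfunion_cls R G V0 V1 A) *m avgmx F (@cfunion_cls R G V0 V1 A) =
  blkmx (fun v => if v \in V1 then total_avg F A
                  else if v \in V0 then block_avg F A else 1%:M).
Proof.
rewrite pullmx_avgmx; apply: eq_kmx => -[v k] [w l].
rewrite cfunion_cls_eq fibre_card_cfunion /glued_at /=.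
case: (v == w); rewrite /= ?mul0r // mul1r.
case: (v \in V1); first by rewrite mxE !orbT mul1r.
case: (v \in V0); rewrite mxE ?enum_rankK /= ?orbF.
  by congr (_ %:R / _); case: eqP => //= ->; rewrite eqxx.
by rewrite (inj_eq enum_rank_inj) divr1.
Qed.

Lemma cfunion_isospectral (R : realType) (G : mgraph R) (V0 V1 : {set vert G})
    (A B : seq nat) :
  all (fun a => 0 < a)%N A -> all (fun a => 0 < a)%N B ->
  size A = size B -> sumn A = sumn B -> (0 < sumn A)%N ->
  isospectral (cfunion V0 V1 A) (cfunion V0 V1 B).
Proof.
move=> A0 B0 sAB nAB nA0 l.
have nB0 : (0 < sumn B)%N by rewrite -nAB.
have cAB : #|copies A| = #|copies B| by rewrite !card_copies.
(* One [X] conjugates both averages at once, so the same matrix can serve in the block of every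
   vertex. *)
have [X [Y [XY YX totX blkX]]] := nested_idempotents_conj cAB
  (total_avg_idem R[i] A) (block_avg_idem _ A) (total_block_avg _ A) (block_total_avg _ A)
  (total_avg_idem _ B) (block_avg_idem _ B) (total_block_avg _ B) (block_total_avg _ B)
  (etrans (total_avg_trace _ nA0) (esym (total_avg_trace _ nB0)))
  (etrans (block_avg_trace _ A0) (etrans (congr1 _ sAB) (esym (block_avg_trace _ B0)))).
rewrite (lap_glued (cfunion_glued V0 V1 A)) (lap_glued (cfunion_glued V0 V1 B)).
apply: (compression_conj (U := blkmx (fun _ : vert G => X))
                         (U' := blkmx (fun _ : vert G => Y))).
- exact: avgmx_pullmx (glue_surj (cfunion_glued V0 V1 A)).
- exact: avgmx_pullmx (glue_surj (cfunion_glued V0 V1 B)).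
- by rewrite blkmxM XY blkmx1.
- by rewrite blkmxM YX blkmx1.
(* The projections are compared block by block: total average, block average, identity. *)
- rewrite !pullmx_avgmx_cfunion !blkmxM; apply: eq_blkmx => v.
  by case: ifP => // _; case: ifP => // _; rewrite mul1mx mulmx1.
- exact: ampmx_blkmx.
Qed.

(** * Degrees *)

(** The test function [g] reads off the multiset of degrees. The sum is taken over all copies, each
    weighted by the inverse of its class size. *)
Lemma sum_degw_cfunion (F : numFieldType) (R : realType) (G : mgraph R)
    (V0 V1 : {set vert G}) (A : seq nat) (g : R -> F) : (0 < sumn A)%N ->
  \sum_(x : vert (cfunion V0 V1 A)) g (degw x) =
  \sum_(v : vert G) if v \in V1 then g (degw v * (sumn A)%:R)
    else if v \in V0 then \sum_(a <- A | (0 < a)%N) g (degw v * a%:R)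
    else g (degw v) *+ sumn A.
Proof.
move=> A0.
have glued := cfunion_glued V0 V1 A.
rewrite (sum_fibre_avg (glue_surj glued) (fun x => g (degw x))).
transitivity (\sum_v \sum_k g (degw (cfunion_cls V0 V1 (v, k)))
    / (fibre_card (@cfunion_cls R G V0 V1 A) (cfunion_cls V0 V1 (v, k)))%:R).
  by rewrite pair_bigA; apply: eq_bigr => -[v k].
apply: eq_bigr => v _.
under eq_bigr do rewrite (degw_glued glued) /= fibre_card_cfunion.
case: (v \in V1).
  by rewrite sumr_const card_copies -[LHS]mulr_natr divfK // pnatr_eq0 -lt0n.
case: (v \in V0); last first.
  by rewrite sumr_const card_copies mulr1 divr1.
rewrite sum_copies (big_nth 0%N) big_mkord [RHS]big_mkcond; apply: eq_bigr => i _ /=.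
(* A part equal to zero has no copies, in accordance with the filter [0 < a]. *)
rewrite sumr_const card_ord -[LHS]mulr_natr; case: posnP => [->|a0]; first by rewrite mulr0.
by rewrite divfK // pnatr_eq0 -lt0n.
Qed.

(** Both sums count pairs with product [z]. Multiplicities of [n] in [A] and [B] are compared by
    strong induction on [n]. *)
Lemma perm_eq_scaled_counts (R : realFieldType) (I : finType) (D : {set I}) (d : I -> R)
    (A B : seq nat) :
  D != set0 -> {in D, forall i, 0 < d i} ->
  (forall z, \sum_(i in D) count (fun a => d i * a%:R == z)%R A
           = \sum_(i in D) count (fun a => d i * a%:R == z)%R B)%N ->
  perm_eq A B.
Proof.
move=> /set0Pn [i0 Di0] d_gt0 eqAB; apply/allP => n _; apply/eqP => /=.
elim/ltn_ind: n => n IHn.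
(* At the smallest scale [d i1], the value [d i1 * n] is reached at every other scale
   only from multiplicands smaller than [n], which are covered by induction. *)
have [i1 Di1 i1_min] := Order.TotalTheory.arg_minP d Di0.
pose z := d i1 * n%:R.
have scaled_inj i : i \in D -> forall a b, (d i * a%:R == d i * b%:R) = (a == b).
  by move=> Di a b; rewrite (inj_eq (mulfI (lt0r_neq0 (d_gt0 i Di)))) eqr_nat.
(* At a scale with [d i * n = z], only the multiplicand [n] gives [z]. *)
have split_level X : (\sum_(i in D) count (fun a => d i * a%:R == z)%R X =
    #|[set i in D | d i * n%:R == z]%R| * count_mem n X +
    \sum_(i in D | (d i * n%:R != z)%R) count (fun a => d i * a%:R == z)%R X)%N.
  rewrite (bigID (fun i => d i * n%:R == z)) /= -sum_nat_const; congr addn.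
  apply: eq_big => [i|i /andP[Di /eqP<-]]; first by rewrite inE.
  by apply: eq_count => a; rewrite /= scaled_inj.
have eq_high : (\sum_(i in D | (d i * n%:R != z)%R) count (fun a => d i * a%:R == z)%R A =
    \sum_(i in D | (d i * n%:R != z)%R) count (fun a => d i * a%:R == z)%R B)%N.
  apply: eq_bigr => i /andP[Di ni].
  have lt_n a : d i * a%:R == z -> (a < n)%N.
    move=> /eqP az; rewrite ltn_neqAle; apply/andP; split.
      by apply: contraNneq ni => <-; apply/eqP.
    rewrite -(ler_nat R) -(ler_pM2l (d_gt0 i Di)) az.
    by rewrite ler_wpM2r // i1_min.
  (* If [z / d i] is not a natural number below [n], both counts are zero. *)
  case: (boolP [exists m : 'I_n, d i * m%:R == z]) => [/existsP[m /eqP mz]|no_m].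
    have cnt X : count (fun a => d i * a%:R == z)%R X = count_mem (m : nat) X.
      by apply: eq_count => a; rewrite -mz /= scaled_inj.
    by rewrite !cnt IHn.
  have cnt X : count (fun a => d i * a%:R == z)%R X = 0%N.
    rewrite (@eq_count _ _ pred0) ?count_pred0 // => a /=.
    by apply: contraNF no_m => az; apply/existsP; exists (Ordinal (lt_n a az)).
  by rewrite !cnt.
(* The coefficient of the multiplicity of [n] is nonzero, since [i1] itself is counted in it. *)
have := eqAB z; rewrite !split_level eq_high => /addIn/eqP; rewrite eqn_pmul2l => [/eqP //|].
by apply/card_gt0P; exists i1; rewrite inE eqxx andbT.
Qed.

Lemma degw_misomorphic (R : realType) (G H : mgraph R) (fV : vert G -> vert H)
    (fE : edge G -> edge H) :
  injective fV -> bijective fE -> (forall e, src (fE e) = fV (src e)) ->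
  (forall e, wt (fE e) = wt e) -> forall v, degw (fV v) = degw v.
Proof.
move=> fVi fEb fs fw v; rewrite /degw (reindex _ (onW_bij _ fEb)) /=.
by apply: eq_big => [e|e _]; rewrite ?fw // !inE fs (inj_eq fVi).
Qed.

Lemma cfunion_misomorphic (R : realType) (G : mgraph R) (V0 V1 : {set vert G})
    (A B : seq nat) :
  (forall v : vert G, 0 < degw v) -> V1 \proper V0 ->
  all (fun a => 0 < a)%N A -> all (fun a => 0 < a)%N B ->
  sumn A = sumn B -> (0 < sumn A)%N ->
  misomorphic (cfunion V0 V1 A) (cfunion V0 V1 B) -> perm_eq A B.
Proof.
move=> d_gt0 /properP[_ [v0 v00 v01]] A0 B0 nAB nA0 [fV [fE [fVb [fEb [fst' [_ [fw _]]]]]]].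
have degE := degw_misomorphic (bij_inj fVb) fEb (fun e => proj1 (fst' e)) fw.
apply: (@perm_eq_scaled_counts R _ (V0 :\: V1) (@degw R G)) => [|v _|z]; first 2 last.
(* With the indicator of [z] as test function, the sum counts the vertices of degree [z]. *)
- pose g (x : R) : rat := (x == z)%:R.
  have countE X v : all (fun a => 0 < a)%N X ->
     \sum_(a <- X | (0 < a)%N) g (degw v * a%:R) =
     (count (fun a => degw v * a%:R == z) X)%:R.
    move=> /allP X0; rewrite -sum1_count natr_sum [RHS]big_mkcond.
    rewrite big_seq_cond [RHS]big_seq_cond; apply: eq_big => [a|a _].
      by case: (boolP (a \in X)) => //= /X0 ->.
    by rewrite /g; case: eqP.
  have := sum_degw_cfunion V0 V1 g nA0.
  have <- : \sum_(x : vert (cfunion V0 V1 B)) g (degw x) = 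
     \sum_(x : vert (cfunion V0 V1 A)) g (degw x).
    by rewrite (reindex _ (onW_bij _ fVb)); apply: eq_bigr => x _; rewrite degE.
  rewrite sum_degw_cfunion -?nAB // => /eqP; rewrite -subr_eq0 -sumrB.
  (* In the difference, the terms outside [V0 :\: V1] cancel because they depend only on the common
     sum of the parts. *)
  rewrite (eq_bigr (fun v => if v \in V0 :\: V1 then
     (count (fun a => degw v * a%:R == z) B)%:R - (count (fun a => degw v * a%:R == z) A)%:R
     else 0)).
    by rewrite -big_mkcond sumrB subr_eq0 -!natr_sum eqr_nat => /eqP.
  move=> v _; rewrite inE; case: (v \in V1); rewrite /= ?subrr //.
  by case: (v \in V0); rewrite ?subrr // !countE.
(* Properness of [V1] in [V0] supplies a scale from which the partition can be recovered. *)
- by apply/set0Pn; exists v0; rewrite inE v00 v01.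
- exact: d_gt0.
Qed.

Theorem theorem5p8 (R : realType) (G : mgraph R) (V0 V1 : {set vert G})
    (s r : nat) (A B : seq nat) :
  is_mgraph G ->
  V1 \proper V0 ->
  (4 <= r)%N ->
  spartition s r A -> spartition s r B ->
  ~~ perm_eq A B ->
  isospectral (cfunion V0 V1 A) (cfunion V0 V1 B) /\
  ~ misomorphic (cfunion V0 V1 A) (cfunion V0 V1 B).
Proof.
move=> [_ [_ [_ [wt_gt0 [_ Ev_gt0]]]]] V10 r4.
move=> /and3P[/eqP sA A0 /eqP nA] /and3P[/eqP sB B0 /eqP nB] nAB.
have r0 : (0 < sumn A)%N by rewrite nA; apply: leq_trans r4.
split; first by apply: cfunion_isospectral => //; rewrite ?sA ?nA.
move/(cfunion_misomorphic _ V10 A0 B0); rewrite nA nB => iso; move/negP: nAB; apply.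
apply: iso => [v|//|]; last by rewrite -nA.
(* Degrees are positive: each vertex has an outgoing edge, and all weights are positive. *)
have /card_gt0P[e ev] := Ev_gt0 v; rewrite /degw (bigD1 e) //= ltr_wpDr ?(wt_gt0 e).1 //.
by apply: sumr_ge0 => e' _; apply/ltW/(wt_gt0 e').1.
Qed.
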